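(* Let $N\ge1$ be an integer and let $A^{[1]}$ be the $(N+1)\times(N+1)$ real matrix, indexed by $k,\ell\in\{0,\ldots,N\}$, with $A^{[1]}_{\ell,\ell}=N-2\ell$, $A^{[1]}_{\ell-1,\ell}=\ell$, $A^{[1]}_{\ell+1,\ell}=-N+\ell$, and all other entries zero. Then a Jordan form of $A^{[1]}$ is $$A^{[1]}=WEW^{-1},$$ where $E$ is the $(N+1)\times(N+1)$ shift matrix, $E_{i,j}=1$ if $j=i+1$ and $E_{i,j}=0$ otherwise, and $W$ is the (invertible) lower-triangular matrix with entries, for $m,n=0,\ldots,N$, $$W_{m,n}=\begin{cases}0,& m\le n-1,\\[2pt] \dfrac{(-1)^{m-n}}{n!}\dbinom{N-n}{m-n},& m\ge n.\end{cases}$$ In particular, $A^{[1]}$ is nilpotent.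
   Context: All matrices are $(N+1)\times(N+1)$ with rows and columns indexed from $0$ to $N$. *)

(* Defs.v *)
From HB Require Import structures.
From mathcomp Require Import all_boot all_order all_algebra.

Set Implicit Arguments.
Unset Strict Implicit.
Unset Printing Implicit Defensive.

Import Order.TTheory GRing.Theory Num.Theory.
Local Open Scope ring_scope.

(* Entries are formed in R: differences of naturals are never truncated. *)
Definition A1_mx (R : realFieldType) (N : nat) : 'M[R]_N.+1 :=
  \matrix_(i, j)
    if (i : nat) == j then N%:R - (2 * j)%:R
    else if i.+1 == j then (j : nat)%:R
    else if (i : nat) == j.+1 then - N%:R + (j : nat)%:R
    else 0.

Definition shift_mx (R : realFieldType) (n : nat) : 'M[R]_n :=
  \matrix_(i, j) if (j : nat) == i.+1 then 1 else 0.

Definition W_mx (R : realFieldType) (N : nat) : 'M[R]_N.+1 :=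
  \matrix_(m, n)
    if (m < n)%N then 0
    else (-1) ^+ (m - n) / (n`!)%:R * 'C(N - n, m - n)%:R.

Definition jordan_block (R : realFieldType) (n : nat) (a : R) : 'M[R]_n :=
  a%:M + shift_mx R n.

(* Block diagonal with Jordan blocks of positive sizes p i; the cast identifies
   the dimension n with the sum of the block sizes. *)
Definition is_jordan_mx (R : realFieldType) (n : nat) (J : 'M[R]_n) : Prop :=
  exists (k : nat) (p : 'I_k -> nat) (a : 'I_k -> R)
         (e : (\sum_(i < k) p i)%N = n),
    (forall i, (0 < p i)%N) /\
    J = castmx (e, e) (\mxdiag_(i < k) jordan_block (p i) (a i)).

Definition jordan_form_of (R : realFieldType) (n : nat) (A W J : 'M[R]_n) :
    Prop :=
  [/\ is_jordan_mx J, W \in unitmx & A = W *m J *m invmx W].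

Definition nilpotent_mx (R : realFieldType) (N : nat) (A : 'M[R]_N.+1) : Prop :=
  exists k : nat, A ^+ k = 0.

(* Main.v *)
(* Read a column vector as the coefficients of a polynomial p in x: then A1_mx
   is the operator p |-> (1-x)^2 p' + N (1-x) p, and column n of W_mx is
   w_n = x^n (1-x)^(N-n) / n!.  This operator maps w_0 to 0 and w_n to w_(n-1),
   so A W = W E; comparing coefficients, this is Pascal's rule. *)
Require Import Defs.
From HB Require Import structures.
From mathcomp Require Import all_boot all_order all_algebra.
From mathcomp Require Import ring zify.

Set Implicit Arguments.
Unset Strict Implicit.
Unset Printing Implicit Defensive.

Import Order.TTheory GRing.Theory Num.Theory.
Local Open Scope ring_scope.

(* The entries of W_mx, with the row index also allowed to be N + 1. *)
Definition W_coef (R : realFieldType) (N m n : nat) : R :=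
  if (m < n)%N then 0
  else (-1) ^+ (m - n) / (n`!)%:R * 'C(N - n, m - n)%:R.

Lemma W_coef_lt (R : realFieldType) (N m n : nat) :
  (m < n)%N -> W_coef R N m n = 0.
Proof. by rewrite /W_coef => ->. Qed.

Lemma W_coef_addn (R : realFieldType) (N n d : nat) :
  W_coef R N (n + d) n = (-1) ^+ d / (n`!)%:R * 'C(N - n, d)%:R.
Proof. by rewrite /W_coef ltnNge leq_addr addKn. Qed.

Lemma natr_mul_bin_left (R : pzRingType) (M d : nat) : (d <= M)%N ->
  d.+1%:R * 'C(M, d.+1)%:R = (M%:R - d%:R) * 'C(M, d)%:R :> R.
Proof. by move=> dM; rewrite -natrB// -!natrM mul_bin_left. Qed.

(** Entry [(m, n)] of [A W = W E]: the left terms come from the diagonal, superdiagonal and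
    subdiagonal of row [m] of [A1_mx]. *)
Lemma W_coef_rec (R : realFieldType) (N m n : nat) :
  (m <= N)%N -> (n <= N)%N ->
  (N%:R - (2 * m)%:R) * W_coef R N m n + m.+1%:R * W_coef R N m.+1 n
    + (if m is m'.+1 then (- N%:R + m'%:R) * W_coef R N m' n else 0)
  = if n is n'.+1 then W_coef R N m n' else 0.
Proof.
move=> mN nN.
have f0 k : k`!%:R != 0 :> R by rewrite pnatr_eq0 -lt0n fact_gt0.
have s0 k : 1 + k%:R != 0 :> R by rewrite addrC natr1 pnatr_eq0.
case: (ltnP m n) => [|le_nm].
  (* Above the diagonal every term vanishes unless the column is [m + 1], where both sides equal
     [1 / m!]. *)
  case: n nN => // n nN; rewrite ltnS leq_eqVlt => /orP[/eqP ->|lt_mn].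
    have := W_coef_addn R N n.+1 0; have := W_coef_addn R N n 0.
    rewrite !addn0 !bin0 expr0 => -> ->; rewrite W_coef_lt//.
    have -> : (if n is m'.+1 then (- N%:R + m'%:R) * W_coef R N m' n.+1 else 0)
              = 0.
      by case: n nN => // n _; rewrite W_coef_lt ?mulr0.
    by rewrite factS natrM; field; rewrite f0 s0.
  rewrite !W_coef_lt ?mulr0 ?ltnS ?(ltnW lt_mn)//.
  by case: m lt_mn mN => [|m] lt_mn _; rewrite ?W_coef_lt ?mulr0 ?addr0 //; lia.
(* Writing [m = n + d] and [N = n + M] removes truncated subtraction; every term becomes a multiple
   of [(-1)^d / n!]. *)
have [d Dm] : exists d, m = (n + d)%N by exists (m - n)%N; rewrite subnKC.
rewrite {m le_nm}Dm in mN *.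
have [M DN] : exists M, N = (n + M)%N by exists (N - n)%N; rewrite subnKC.
rewrite {N nN}DN leq_add2l in mN *.
have E1 := natr_mul_bin_left R mN.
(* The factor [d] covers [d = 0], where row [m - 1] is absent or meets column [n] above the
   diagonal. *)
have -> : (if (n + d)%N is m'.+1
           then (- (n + M)%:R + m'%:R) * W_coef R (n + M) m' n else 0)
          = (-1) ^+ d / n`!%:R * (d%:R * 'C(M, d)%:R).
  case: d mN {E1} => [|d] mN; last first.
    rewrite addnS W_coef_addn addKn (natr_mul_bin_left R (ltnW mN)) exprS.
    by rewrite !natrD; ring.
  rewrite mul0r mulr0 addn0; case: n => // n.
  by rewrite W_coef_lt ?mulr0.
rewrite -addnS !W_coef_addn addKn.
(* Pascal's rule for ['C(M + 1, d + 1)]; the factor [n] turns [1 / n!] into [1 / (n - 1)!] and gives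
   0 at [n = 0]. *)
have -> : (if n is n'.+1 then W_coef R (n + M) (n + d) n' else 0)
          = (-1) ^+ d.+1 / n`!%:R * (n%:R * ('C(M, d.+1)%:R + 'C(M, d)%:R)).
  case: n => [|n]; first by rewrite mul0r mulr0.
  rewrite !addSnnS W_coef_addn addKn binS natrD factS natrM.
  by field; rewrite f0 s0.
have -> : (n + d.+1)%:R * ((-1) ^+ d.+1 / n`!%:R * 'C(M, d.+1)%:R)
  = (-1) ^+ d.+1 / n`!%:R * (n%:R * 'C(M, d.+1)%:R + d.+1%:R * 'C(M, d.+1)%:R) :> R.
  by rewrite natrD; ring.
(* The coefficients of ['C(M, d)] agree: [(n + M) - 2 (n + d) - (M - d) + d = -n]. *)
by rewrite E1 exprS natrM !natrD; ring.
Qed.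

Lemma mul_A1_W (R : realFieldType) (N : nat) :
  A1_mx R N *m W_mx R N = W_mx R N *m shift_mx R N.+1.
Proof.
apply/matrixP => i j; rewrite !mxE.
have WE (k l : 'I_N.+1) : W_mx R N k l = W_coef R N k l by rewrite mxE.
(* Right multiplication by the shift moves the columns of [W_mx] one place to the right. *)
transitivity (if j : nat is n'.+1 then W_coef R N i n' else 0); last first.
  under eq_bigr do rewrite WE mxE -[X in _ * X]/(if _ then _ else _).
  case: j => -[|j] /= lt_j.
    by rewrite big1// => k _; rewrite mulr0.
  rewrite (eq_bigr (fun k : 'I_N.+1 => if k == j :> nat then W_coef R N i k else 0)).
    by rewrite -big_mkcond big_ord1_eq (ltnW lt_j).
  by move=> k _; rewrite eqSS eq_sym; case: eqP => _; rewrite ?mulr1 ?mulr0.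
rewrite -(W_coef_rec R (leq_ord i) (leq_ord j)).
pose F (k : nat) := W_coef R N k j.
rewrite (eq_bigr (fun k : 'I_N.+1 =>
  (if k == i :> nat then (N%:R - (2 * k)%:R) * F k else 0)
  + (if k == i.+1 :> nat then k%:R * F k else 0)
  + (if (i : nat) is m.+1 then
       if k == m :> nat then (- N%:R + k%:R) * F k else 0 else 0))); last first.
  move=> k _; rewrite WE -/(F k) mxE [k == i :> nat]eq_sym [k == i.+1 :> nat]eq_sym.
  have -> : (if (i : nat) is m.+1 then
     if (k : nat) == m then (- N%:R + k%:R) * F k else 0 else 0)
     = if i == k.+1 :> nat then (- N%:R + k%:R) * F k else 0.
    by case: (i : nat) => // m; rewrite eqSS eq_sym.
  do 3?case: eqP => ?; rewrite ?mul0r ?addr0 ?add0r //; lia.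
rewrite !big_split/= -!big_mkcond/=.
rewrite (big_ord1_eq _ (fun k => (N%:R - (2 * k)%:R) * F k)).
rewrite (big_ord1_eq _ (fun k => k%:R * F k)) ltn_ord; congr (_ + _ + _).
  (* In the last row, [i = N], the sum has no term of index [N + 1]; accordingly
     ['C(N - j, N + 1 - j) = 0]. *)
  case: ltnP => // leNi; rewrite /W_coef.
  have [//|_] := ltnP i.+1 j; first by rewrite mulr0.
  by rewrite bin_small ?mulr0 //; have := ltn_ord i; have := ltn_ord j; lia.
case: i => -[|i] /= lt_i; first by rewrite big1.
rewrite -big_mkcond (big_ord1_eq _ (fun k => (- N%:R + k%:R) * F k)).
by rewrite (ltnW lt_i).
Qed.

Lemma W_mx_trig (R : realFieldType) (N : nat) : is_trig_mx (W_mx R N).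
Proof. by apply/is_trig_mxP => i j lt_ij; rewrite mxE lt_ij. Qed.

(** The determinant is the product of the diagonal entries [1 / n!]. *)
Lemma W_mx_unit (R : realFieldType) (N : nat) : W_mx R N \in unitmx.
Proof.
rewrite unitmxE (det_trig (W_mx_trig R N)) unitfE prodf_seq_neq0.
apply/allP => i _; rewrite mxE ltnn subnn bin0 expr0 mul1r mulr1 /=.
by rewrite invr_eq0 pnatr_eq0 -lt0n fact_gt0.
Qed.

Lemma shift_mx_jordan (R : realFieldType) (n : nat) :
  is_jordan_mx (shift_mx R n.+1).
Proof.
have e : (\sum_(i < 1) n.+1)%N = n.+1 by rewrite big_ord1.
exists 1%N, (fun=> n.+1), (fun=> 0), e; split=> //.
apply/matrixP => i j; rewrite castmxE mxE [RHS]mxE !ord1 eqxx conform_mx_id.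
have sum_lt0 (a : 'I_1) : (\sum_(i < 1 | i < a) n.+1)%N = 0%N.
  by rewrite big_pred0 // => l; rewrite !ord1.
(* No block precedes the only one, so the cast leaves the position inside the block unchanged. *)
have val2 (k : 'I_n.+1) : tagnat.sig2 (cast_ord (esym e) k) = k :> nat.
  exact: esym (etrans (tagnat.rect (cast_ord (esym e) k))
                      (congr1 (addn^~ _) (sum_lt0 _))).
by rewrite /jordan_block raddf0 add0r mxE !val2.
Qed.

Lemma shift_mx_expE (R : realFieldType) (n k : nat) (i j : 'I_n.+1) :
  (shift_mx R n.+1 ^+ k) i j = (j == (i + k)%N :> nat)%:R.
Proof.
elim: k i j => [|k IHk] i j; first by rewrite expr0 mxE addn0 eq_sym.
rewrite exprS mxE.
rewrite (eq_bigr (fun l : 'I_n.+1 =>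
  if l == i.+1 :> nat then (j == (l + k)%N :> nat)%:R else 0)); last first.
  by move=> l _; rewrite IHk mxE; case: eqP; rewrite ?mul1r ?mul0r.
rewrite -big_mkcond (big_ord1_eq _ (fun l => (j == (l + k)%N :> nat)%:R)).
(* If row [i + 1] does not exist, column [i + 1 + k] does not either. *)
rewrite addnS addSn; case: ltnP => // le_ni.
by case: eqP => // Dj; have := ltn_ord j; lia.
Qed.

Theorem theorem3 (R : realFieldType) (N : nat) (hN : (1 <= N)%N) :
  [/\ is_trig_mx (W_mx R N),
      jordan_form_of (A1_mx R N) (W_mx R N) (shift_mx R N.+1)
    & nilpotent_mx (A1_mx R N)].
Proof.
have Wu := W_mx_unit R N.
have AE : A1_mx R N = W_mx R N *m shift_mx R N.+1 *m invmx (W_mx R N).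
  by rewrite -mul_A1_W mulmxK.
split; [exact: W_mx_trig | by split=> //; exact: shift_mx_jordan | ].
(* The exponent is the size of the matrix: the diagonal [j = i + N + 1] is empty, so this power of
   the shift is 0, and [AX] carries this over to [A1_mx]. *)
exists N.+1.
have AX k : A1_mx R N ^+ k *m W_mx R N = W_mx R N *m shift_mx R N.+1 ^+ k.
  elim: k => [|k IHk]; first by rewrite !expr0 mul1mx mulmx1.
  by rewrite exprSr -mulmxA mul_A1_W mulmxA IHk -mulmxA exprSr.
rewrite -(mulmxK Wu (A1_mx R N ^+ N.+1)) AX.
have -> : shift_mx R N.+1 ^+ N.+1 = 0.
  apply/matrixP => i j; rewrite shift_mx_expE mxE.
  by case: eqP => // Dj; have := ltn_ord j; lia.
by rewrite mulmx0 mul0mx.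
Qed.
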